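(* Let $\varepsilon\in(0,1)$, $N_\varepsilon\ge1$ an integer, $\|f'\|<\infty$, and let $h\in[0,1]^{N_\varepsilon}$ be a random vector depending on the observations only through $(x_k^2+{x_k^*}^2)_k$. Then for every $x\in[0,\sqrt{N_\varepsilon/6}]$, $${\bf P}_{\vartheta,f}\Big(|\Phi_\varepsilon'(\vartheta,h)|>2x\varepsilon\big(\|f'\|+2\pi\varepsilon N_\varepsilon^{3/2}\big)\Big)\le2e^{-x^2}.$$
   Context: Model: $\vartheta\in\mathbb R$, $f$ locally square integrable, even, $1$-periodic; $f_k=\sqrt2\int_{-1/2}^{1/2}\cos(2\pi kt)f(t)dt$, $\|f'\|^2=\sum_{k\ge1}(2\pi k)^2f_k^2$. Observations $x_k=f_k\cos(2\pi k\vartheta)+\varepsilon\xi_k$, $x_k^*=f_k\sin(2\pi k\vartheta)+\varepsilon\xi_k^*$, $\xi_k,\xi_k^*$ i.i.d. $\mathcal N(0,1)$, law ${\bf P}_{\vartheta,f}$. $h\in[0,1]^N$ extended by $0$; $\Phi_\varepsilon(\tau,h)=\frac12\sum_kh_k(x_k\cos(2\pi k\tau)+x_k^*\sin(2\pi k\tau))^2$; $\Phi'_\varepsilon$ is the derivative in $\tau$. *)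

(* Defs.v *)
From HB Require Import structures.
From mathcomp Require Import all_boot all_order all_algebra.
From mathcomp Require Import all_classical all_reals all_analysis.
Set Implicit Arguments. Unset Strict Implicit. Unset Printing Implicit Defensive.
Import Order.TTheory GRing.Theory Num.Theory.
Import numFieldNormedType.Exports.
Local Open Scope classical_set_scope.
Local Open Scope ring_scope.

Section Model.
Context {R : realType}.

Definition admissible_signal (f : R -> R) : Prop :=
  [/\ measurable_fun [set: R] f,
      (forall a b : R, lebesgue_measure.-integrable `[a, b] (fun t => ((f t) ^+ 2)%:E)),
      (forall t, f (- t) = f t) &
      (forall t, f (t + 1) = f t)].

Definition fcoef (f : R -> R) (k : nat) : R :=
  Num.sqrt 2 * Rintegral lebesgue_measure `[(- (1/2)), 1/2]
                 (fun t => cos (2 * pi * k%:R * t) * f t).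

(* terms of ||f'||^2 = sum_{k>=1} (2 pi k)^2 f_k^2 (the k = 0 term vanishes) *)
Definition dnorm_terms (f : R -> R) (k : nat) : R :=
  (2 * pi * k%:R) ^+ 2 * (fcoef f k) ^+ 2.

Definition dnorm_finite (f : R -> R) : Prop := cvg (series (dnorm_terms f) @ \oo).

Definition dnorm (f : R -> R) : R := Num.sqrt (limn (series (dnorm_terms f))).

Definition Phi (N : nat) (x xs : nat -> R) (h : nat -> R) (tau : R) : R :=
  2^-1 * \sum_(1 <= k < N.+1)
     h k * (x k * cos (2 * pi * k%:R * tau) + xs k * sin (2 * pi * k%:R * tau)) ^+ 2.

Definition dPhi (N : nat) (x xs : nat -> R) (h : nat -> R) (tau : R) : R :=
  derive1 (Phi N x xs h) tau.

Definition xobs (th : R) (f : R -> R) (eps : R) (xi : nat -> R) (k : nat) : R :=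
  fcoef f k * cos (2 * pi * k%:R * th) + eps * xi k.
Definition xsobs (th : R) (f : R -> R) (eps : R) (xis : nat -> R) (k : nat) : R :=
  fcoef f k * sin (2 * pi * k%:R * th) + eps * xis k.

Definition mutually_independent {d} {T : measurableType d} {I : eqType}
    (P : probability T R) (X : I -> T -> R) : Prop :=
  forall (J : seq I) (B : I -> set R), uniq J -> (forall i, measurable (B i)) ->
    P (\bigcap_(i in [set` J]) (X i @^-1` B i)) = (\prod_(i <- J) P (X i @^-1` B i))%E.

Definition iid_std_normal {d} {T : measurableType d} (P : probability T R)
    (xi xis : nat -> T -> R) : Prop :=
  let X := fun i : bool * nat => if i.1 then xi i.2 else xis i.2 in
  [/\ (forall i, measurable_fun [set: T] (X i)),
      (forall i B, measurable B -> P (X i @^-1` B) = normal_prob 0 1 B) &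
      mutually_independent P X].

Definition gen_sigma {d} {T : measurableType d} (r : nat -> T -> R) : set (set T) :=
  <<s [set A | exists j B, [/\ (1 <= j)%N, measurable B & A = r j @^-1` B]] >>.

End Model.

(* Main.v *)
(** Rotating each pair of observations by the angle [2 pi k th] turns it into
    [(f_k + eps zeta_k, eps eta_k)] with [zeta_k], [eta_k] again i.i.d. standard
    normal, so that [Phi'(th) = sum_k 2 pi k h_k (f_k + eps zeta_k) eps eta_k].  The
    weights [h_k] depend on the [eta_k] only through [|eta_k|], hence given
    everything but the signs of the [eta_k] these signs are independent and fair.
    Averaging over the sign of [eta_k] turns [exp (l h_k t eta_k)] into
    [cosh (l h_k t eta_k) <= cosh (l t eta_k)], so each [h_k] may be replaced by [1]
    in the moment generating function, which then factorises.  A Gaussian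
    computation bounds each factor by [exp (a^2 (1 + p^2))] with
    [a = 2 pi k l eps^2] and [p = f_k / eps] as soon as [a^2 <= 1/2], and
    Chernoff's bound with [l = x / (eps (||f'|| + 2 pi eps N^(3/2)))] concludes. *)
From HB Require Import structures.
From mathcomp Require Import all_boot all_order all_algebra.
From mathcomp Require Import all_classical all_reals all_analysis.
From mathcomp Require Import measurable_realfun ring lra.
Require Import Defs.
Import Order.TTheory GRing.Theory Num.Theory.
Import numFieldNormedType.Exports.
Set Implicit Arguments. Unset Strict Implicit. Unset Printing Implicit Defensive.
Local Open Scope classical_set_scope.
Local Open Scope ring_scope.

(** * Change of variables *)

Section density.
Local Open Scope ereal_scope.
Context d (T : measurableType d) (R : realType).
Variables (mu nu : {measure set T -> \bar R}) (rho : T -> R).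
Hypothesis rho0 : forall x, (0 <= rho x)%R.
Hypothesis mrho : measurable_fun setT rho.
Hypothesis nuE : forall A, measurable A -> nu A = \int[mu]_(x in A) (rho x)%:E.

Import HBNNSimple.

(** The hypothesis [nuE] only speaks of sets. Linearity carries it to simple functions, and monotone
    convergence along [nnsfun_approx] to every nonnegative measurable [g]. *)
Lemma ge0_integral_density (g : T -> \bar R) :
  (forall x, 0 <= g x) -> measurable_fun setT g ->
  \int[nu]_x g x = \int[mu]_x (g x * (rho x)%:E).
Proof.
move=> g0 mg; pose g_ := nnsfun_approx measurableT mg.
have gE x : limn (EFin \o g_^~ x) = g x.
  by apply/cvg_lim => //; exact: cvg_nnsfun_approx.
transitivity (limn (fun n => \int[nu]_x (g_ n x)%:E)).
  rewrite -monotone_convergence//.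
  - by apply: eq_integral => y _; rewrite -gE.
  - by move=> n; exact/measurable_EFinP/measurable_funP.
  - by move=> n y _; rewrite lee_fin.
  - by move=> y _ m n mn; rewrite lee_fin; exact/lefP/nd_nnsfun_approx.
have mrhoE : measurable_fun [set: T] (EFin \o rho) by exact/measurable_EFinP.
transitivity (limn (fun n => \int[mu]_x ((g_ n x)%:E * (rho x)%:E))); last first.
  rewrite -monotone_convergence//.
  - apply: eq_integral => y _; apply/cvg_lim => //.
    apply: cvgeZr => //; exact: cvg_nnsfun_approx.
  - move=> n; apply: emeasurable_funM => //.
    exact/measurable_EFinP/measurable_funP.
  - by move=> n y _; rewrite mule_ge0// lee_fin.
  - move=> y _ m n mn; rewrite lee_wpmul2r ?lee_fin//.
    exact/lefP/nd_nnsfun_approx.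
congr (limn _); apply/funext => n.
transitivity (\sum_(k \in range (g_ n)) (k%:E * nu (g_ n @^-1` [set k]))).
  by rewrite integralT_nnsfun sintegralE.
(* The simple function is expanded over its level sets, so that [nuE] can be applied to each of
   them. *)
under [RHS]eq_integral => x _.
  rewrite (_ : (g_ n x)%:E * (rho x)%:E =
    \sum_(k \in range (g_ n)) ((k * (\1_(g_ n @^-1` [set k]) x * rho x))%:E)).
    over.
  rewrite fimfunE -EFinM mulr_fsuml fsumEFin//; congr EFin.
  by apply: eq_fsbigr => k _; rewrite mulrA.
rewrite ge0_integral_fsum//=.
- apply: eq_fsbigr => k; rewrite inE => -[x _ <-].
  under [RHS]eq_integral do rewrite EFinM.
  rewrite ge0_integralZl ?lee_fin//.
  + rewrite nuE// integral_mkcond; congr (_ * _).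
    apply: eq_integral => y _; rewrite patchE indicE.
    by case: ifP; rewrite ?mul1r ?mul0r.
  + by apply/measurable_EFinP; apply: measurable_funM.
  + by move=> y _; rewrite lee_fin mulr_ge0.
- move=> k; apply/measurable_EFinP; apply: measurable_funM => //.
  by apply: measurable_funM.
- move=> k x _; rewrite lee_fin mulrA mulr_ge0//.
  by have := nnfun_muleindic_ge0 (g_ n) k x; rewrite -EFinM lee_fin.
Qed.

End density.

Section affine.
Context {R : realType}.
Notation mu := (@lebesgue_measure R).
Let aff (a b : R) (x : measurableTypeR R) : measurableTypeR R := (a * x + b)%R.

Let measurable_aff (a b : R) : measurable_fun setT (aff a b).
Proof. by apply: measurable_funD => //; apply: measurable_funM. Qed.

(** A negative slope turns the interval around and moves the closed end to the left; the length is
    the same in both cases. *)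
Let preimage_aff_oc (a b p q : R) : a != 0 ->
  mu (aff a b @^-1` `]p, q]) = (`|a|^-1%:E * mu `]p, q])%E.
Proof.
move=> a0; have [a_lt0|a_gt0|/eqP] := ltgtP a 0; last by rewrite (negbTE a0).
- have -> : aff a b @^-1` `]p, q] = `[(q - b) / a, (p - b) / a[%classic.
    apply/seteqP; split => x; rewrite /aff/= !in_itv/= ler_ndivrMr// ltr_ndivlMr//;
      lra.
  rewrite !lebesgue_measure_itv/= !lte_fin ltr_nM2r ?invr_lt0// ltrBlDr subrK.
  case: ifPn => _; last by rewrite mule0.
  rewrite -!EFinB -EFinM ltr0_norm// -mulrBl; congr EFin.
  by rewrite invrN; ring.
- have -> : aff a b @^-1` `]p, q] = `](p - b) / a, (q - b) / a]%classic.
    apply/seteqP; split => x; rewrite /aff/= !in_itv/= ltr_pdivrMr// ler_pdivlMr//;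
      lra.
  rewrite !lebesgue_measure_itv/= !lte_fin ltr_pM2r ?invr_gt0// ltrBlDr subrK.
  case: ifPn => _; last by rewrite mule0.
  rewrite -!EFinB -EFinM gtr0_norm// -mulrBl; congr EFin; ring.
Qed.

Let affine_lebesgue (a b : R) : {measure set (measurableTypeR R) -> \bar R}.
Proof.
pose m : {measure set (measurableTypeR R) -> \bar R} :=
  mscale (NngNum (normr_ge0 a)) (pushforward mu (aff a b)).
exact: (m (measurable_aff a b)).
Defined.

(** The right-hand side is a measure in [A] that agrees with Lebesgue measure on the intervals []p,
    q]], and these determine it. *)
Lemma lebesgue_measure_affine (a b : R) (A : set R) : a != 0 -> measurable A ->
  mu A = (`|a|%:E * mu ((fun x => a * x + b)%R @^-1` A))%E.
Proof.
move=> a0 mA.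
pose m' := affine_lebesgue a b.
transitivity (m' A); last by [].
apply: lebesgue_measure_unique mA => _ [[p q] _ <-] /=.
rewrite /m'/= /mscale/= /pushforward preimage_aff_oc//.
by rewrite muleA -EFinM mulfV ?normr_eq0// mul1e.
Qed.

Lemma ge0_integral_affine (a b : R) (F : R -> \bar R) : a != 0 ->
  measurable_fun setT F -> (forall x, 0 <= F x)%E ->
  (\int[mu]_x F (a * x + b)%R = `|a|^-1%:E * \int[mu]_x F x)%E.
Proof.
move=> a0 mF F0.
pose m' := affine_lebesgue a b.
have -> : (\int[mu]_x F x = \int[m']_x F x)%E.
  by apply: eq_measure_integral => A mA _; exact: lebesgue_measure_affine.
rewrite ge0_integral_mscale//= muleA -EFinM mulVf ?normr_eq0// mul1e.
by rewrite ge0_integral_pushforward.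
Qed.

End affine.

Section rotation.
Context {R : realType}.
Notation mu := (@lebesgue_measure R).

Definition rot (c s : R) (z : R * R) : R * R :=
  (c * z.1 + s * z.2, - s * z.1 + c * z.2).

Lemma measurable_rot c s : measurable_fun setT (rot c s).
Proof.
apply: measurable_fun_pair; apply: measurable_funD;
  by apply: measurable_funM => //; exact: measurable_fst || exact: measurable_snd.
Qed.

(* A rotation with [c <> 0] is two one-dimensional affine substitutions, one in
   each coordinate, with Jacobians [|c|^-1] and [|c|]. *)
Lemma ge0_integral_rot (c s : R) (G : R * R -> \bar R) : c ^+ 2 + s ^+ 2 = 1 ->
  measurable_fun setT G -> (forall z, 0 <= G z)%E ->
  (\int[mu]_x \int[mu]_y G (rot c s (x, y)) = \int[mu]_x \int[mu]_y G (x, y))%E.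
Proof.
move=> cs mG G0.
have mGr : measurable_fun setT (G \o rot c s).
  by apply: measurableT_comp => //; exact: measurable_rot.
have mGx x : measurable_fun setT (fun y => G (x, y)).
  by apply: measurableT_comp => //; exact: measurable_pair1.
have mGy y : measurable_fun setT (fun x => G (x, y)).
  by apply: measurableT_comp => //; exact: measurable_pair2.
(* For [c = 0] one cannot divide by [c]; the rotation then exchanges the coordinates up to sign,
   with [|s| = 1]. *)
have [c0|c0] := eqVneq c 0.
  have s0 : s != 0 by apply/eqP => s0; move: cs; rewrite c0 s0; lra.
  have s1 : `|s|^-1 = 1.
    have : `|s| ^+ 2 = 1 by rewrite real_normK ?num_real//; move: cs; rewrite c0; lra.
    by move/eqP; rewrite sqrp_eq1 ?normr_ge0// => /eqP ->; rewrite invr1.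
  transitivity (\int[mu]_x \int[mu]_y G (y, (- s * x + 0)%R))%E.
    apply: eq_integral => x _.
    rewrite -[RHS]mul1e -s1 -(@ge0_integral_affine _ s 0 (fun y => G (y, - s * x + 0)) s0)//.
    by apply: eq_integral => y _; congr G; rewrite /rot c0/=; congr (_, _); ring.
  have m1 : measurable_fun setT (fun z : R * R => G (z.2, - s * z.1 + 0)).
    apply: measurableT_comp => //; apply: measurable_fun_pair => //=.
    by apply: measurable_funD => //; apply: measurable_funM.
  rewrite (fubini_tonelli (m1 := mu) (m2 := mu) (fun z : R * R => G (z.2, - s * z.1 + 0)))//.
  apply: eq_integral => x _ /=.
  rewrite (@ge0_integral_affine _ _ _ (fun y => G (x, y)))// ?oppr_eq0//.
  by rewrite normrN s1 mul1e.
transitivity (\int[mu]_y \int[mu]_x G (rot c s (x, y)))%E.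
  by rewrite (fubini_tonelli (m1 := mu) (m2 := mu) (G \o rot c s))// => z /=.
(* With [x' = c * x + s * y] as new first coordinate, the second one, [- s * x + c * y], equals
   [c^-1 * y - (s / c) * x'] because [c ^+ 2 + s ^+ 2 = 1]. The factor [|c|^-1] is the Jacobian of
   this first substitution. *)
pose H (z : R * R) := (`|c|^-1%:E * G (z.1, (c^-1 * z.2 + - (s / c) * z.1)%R))%E.
have mH : measurable_fun setT H.
  apply: emeasurable_funM => //; apply: measurableT_comp => //.
  apply: measurable_fun_pair => //=.
  by apply: measurable_funD; apply: measurable_funM => //;
     exact: measurable_fst || exact: measurable_snd.
have H0 z : (0 <= H z)%E by rewrite mule_ge0// lee_fin invr_ge0.
transitivity (\int[mu]_y \int[mu]_x H (x, y))%E.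
  apply: eq_integral => y _.
  rewrite /H/= ge0_integralZl//; last first.
  - apply: measurableT_comp => //; apply: measurable_fun_pair => //=.
    by apply: measurable_funD => //; apply: measurable_funM.
  rewrite -(@ge0_integral_affine _ c (s * y) (fun x => G (x, c^-1 * y + - (s / c) * x)))//.
    apply: eq_integral => x _; congr G; congr (_, _) => /=.
    have -> : c * y = (c ^+ 2 + s ^+ 2 - s ^+ 2) / c * y by field.
    by rewrite cs; field.
  apply: measurableT_comp => //; apply: measurable_fun_pair => //=.
  by apply: measurable_funD => //; apply: measurable_funM.
rewrite -(fubini_tonelli (m1 := mu) (m2 := mu) H)//.
apply: eq_integral => x _; rewrite /H/= ge0_integralZl//; last first.
- apply: measurableT_comp => //; apply: measurable_fun_pair => //.
  by apply: measurable_funD => //; apply: measurable_funM.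
rewrite (@ge0_integral_affine _ _ _ (fun y => G (x, y)))// ?invr_eq0//.
by rewrite normfV invrK muleA -EFinM mulVf ?normr_eq0// mul1e.
Qed.

End rotation.

(** * The standard Gaussian measure on the plane *)

Section gauss2.
Context {R : realType}.
Notation mu := (@lebesgue_measure R).
Notation phi := (normal_pdf (0 : R) 1).

(* [normal_prob] lives on the display of [measurableTypeR R]; [stdn] is the same
   measure on the default display of [R], which is the one of random variables. *)
Definition stdn : set R -> \bar R := normal_prob 0 1.

Let stdn0 : stdn set0 = 0%E. Proof. exact: measure0. Qed.
Let stdn_ge0 A : (0 <= stdn A)%E. Proof. exact: measure_ge0. Qed.
Let stdn_sigma_additive : semi_sigma_additive stdn.
Proof. exact: (@measure_semi_sigma_additive _ _ _ (normal_prob (0 : R) 1)). Qed.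
HB.instance Definition _ := isMeasure.Build _ _ _
  stdn stdn0 stdn_ge0 stdn_sigma_additive.
Let stdn_setT : stdn setT = 1%E. Proof. exact: probability_setT. Qed.
HB.instance Definition _ := Measure_isProbability.Build _ _ _ stdn stdn_setT.

Definition gauss2 : probability (R * R)%type R := (stdn \x stdn)%E.

Lemma ge0_integral_stdn (g : R -> \bar R) :
  (forall x, 0 <= g x)%E -> measurable_fun setT g ->
  (\int[stdn]_x g x = \int[mu]_x (g x * (phi x)%:E))%E.
Proof.
move=> g0 mg.
(* The identity, seen as a map between the two displays of [R], pushes [stdn] forward to
   [normal_prob 0 1]. *)
pose toTR : R -> measurableTypeR R := idfun.
have mtoTR : measurable_fun setT toTR by move=> _ A mA; rewrite setTI.
transitivity (\int[normal_prob (0 : R) 1]_x g x)%E.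
  transitivity (\int[pushforward stdn toTR]_x g x)%E.
    by rewrite ge0_integral_pushforward.
  by apply: eq_measure_integral.
apply: ge0_integral_density => //.
- by move=> x; exact: normal_pdf_ge0.
- exact: measurable_normal_pdf.
Qed.

Lemma ge0_integral_gauss2 (g : R * R -> \bar R) :
  (forall x, 0 <= g x)%E -> measurable_fun setT g ->
  (\int[gauss2]_z g z = \int[mu]_x \int[mu]_y (g (x, y) * (phi x * phi y)%:E))%E.
Proof.
move=> g0 mg; rewrite fubini_tonelli1// ge0_integral_stdn//; last 2 first.
- by move=> x; exact: integral_ge0.
- exact: measurable_fun_fubini_tonelli_F.
have mgx x : measurable_fun setT (fun y => g (x, y)).
  by apply: measurableT_comp => //; exact: measurable_pair1.
apply: eq_integral => x _; rewrite /fubini_F ge0_integral_stdn//.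
have mphi : measurable_fun setT (fun y => (phi y)%:E).
  by apply/measurable_EFinP; exact: measurable_normal_pdf.
rewrite -ge0_integralZr//.
- by apply: eq_integral => y _; rewrite EFinM (muleC (phi x)%:E) muleA.
- by apply: emeasurable_funM => //; exact: mgx.
- by move=> y _; rewrite mule_ge0// lee_fin normal_pdf_ge0.
- by rewrite lee_fin normal_pdf_ge0.
Qed.

Lemma gauss2E A : measurable A ->
  gauss2 A = (\int[mu]_x \int[mu]_y ((\1_A (x, y))%:E * (phi x * phi y)%:E))%E.
Proof.
move=> mA; rewrite -(ge0_integral_gauss2 (g := EFin \o \1_A))//.
- by rewrite [RHS](@integral_indic _ _ _ gauss2 _ measurableT A mA) setIT.
- by move=> z; rewrite lee_fin.
- exact/measurable_EFinP.
Qed.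

(** The density depends on [x ^+ 2 + y ^+ 2] only, and iterated Lebesgue integrals are rotation
    invariant. *)
Lemma gauss2_rot (c s : R) (C : set (R * R)) : c ^+ 2 + s ^+ 2 = 1 ->
  measurable C -> gauss2 (rot c s @^-1` C) = gauss2 C.
Proof.
move=> cs mC.
have mrC : measurable (rot c s @^-1` C).
  by rewrite -[X in measurable X]setTI; exact: measurable_rot.
rewrite (gauss2E mrC) (gauss2E mC).
pose G z := ((\1_C z)%:E * (phi z.1 * phi z.2)%:E)%E.
transitivity (\int[mu]_x \int[mu]_y G (rot c s (x, y)))%E; last first.
  apply: ge0_integral_rot => //.
  - apply: emeasurable_funM; first exact/measurable_EFinP.
    by apply/measurable_EFinP; apply: measurable_funM; apply: measurableT_comp => //;
      exact: measurable_normal_pdf.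
  - by move=> z; rewrite mule_ge0// lee_fin// mulr_ge0// normal_pdf_ge0.
apply: eq_integral => x _; apply: eq_integral => y _; congr (_ * _)%E.
rewrite !normal_pdfE ?oner_neq0// /normal_fun; congr EFin.
rewrite mulrACA [RHS]mulrACA -!expRD; congr (_ * expR _) => /=.
rewrite -!mulrDl; congr (_ / _); rewrite !subr0.
transitivity (- ((c ^+ 2 + s ^+ 2) * (x ^+ 2 + y ^+ 2))); last by ring.
by rewrite cs; ring.
Qed.

Lemma stdn_mgf (a : R) :
  (\int[stdn]_y (expR (a * y))%:E = (expR (a ^+ 2 / 2))%:E)%E.
Proof.
rewrite ge0_integral_stdn//; last first.
  by apply/measurable_EFinP; apply: measurableT_comp => //; apply: measurable_funM.
transitivity (\int[mu]_y ((expR (a ^+ 2 / 2))%:E * (normal_pdf a 1 y)%:E))%E.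
  apply: eq_integral => y _; rewrite -!EFinM; congr EFin.
  rewrite !normal_pdfE ?oner_neq0// /normal_fun mulrCA -expRD.
  rewrite [RHS]mulrCA -expRD; congr (_ * expR _).
  by rewrite expr1n; field.
rewrite ge0_integralZl//.
- by rewrite integral_normal_pdf mule1.
- by apply/measurable_EFinP; exact: measurable_normal_pdf.
- by move=> x _; rewrite lee_fin normal_pdf_ge0.
Qed.

(** Completing the square makes the integrand a constant times the normal density with mean
    [s * p / (1 - s)] and standard deviation [(1 - s) ^ (-1/2)]. *)
Lemma stdn_mgf_sqr (s p : R) : 0 <= s < 1 ->
  (\int[stdn]_z (expR (s * (p + z) ^+ 2 / 2))%:E =
   ((Num.sqrt (1 - s))^-1 * expR (s * p ^+ 2 / (2 * (1 - s))))%:E)%E.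
Proof.
move=> /andP[s0 s1]; have s1' : 0 < 1 - s by lra.
pose sg := (Num.sqrt (1 - s))^-1.
have sg0 : 0 < sg by rewrite invr_gt0 sqrtr_gt0.
have sg2 : sg ^+ 2 = (1 - s)^-1 by rewrite exprVn sqr_sqrtr// ltW.
rewrite ge0_integral_stdn//; last first.
  apply/measurable_EFinP; apply: measurableT_comp => //; apply: measurable_funM => //.
  apply: measurable_funM => //; apply: measurable_funX => //.
  exact: measurable_funD.
set K := (X in _ = X%:E).
transitivity (\int[mu]_y (K%:E * (normal_pdf (s * p / (1 - s)) sg y)%:E))%E.
  apply: eq_integral => y _; rewrite -!EFinM; congr EFin.
  rewrite !normal_pdfE ?oner_neq0 ?gt_eqF// /normal_fun /K -/sg.
  have -> : normal_peak 1 = sg * normal_peak sg.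
    rewrite /normal_peak expr1n mul1r -mulrnAr sqrtrM ?sqr_ge0//.
    by rewrite sqrtr_sqr gtr0_norm// invfM mulrA mulfV ?gt_eqF// mul1r.
  rewrite [LHS]mulrCA -expRD.
  rewrite [RHS](_ : _ = sg * normal_peak sg * (expR (s * p ^+ 2 / (2 * (1 - s)))
    * expR (- (y - s * p / (1 - s)) ^+ 2 / (sg ^+ 2 *+ 2)))); last by ring.
  rewrite -expRD; congr (_ * expR _); rewrite sg2 expr1n.
  by field; rewrite gt_eqF.
rewrite ge0_integralZl//.
- by rewrite integral_normal_pdf mule1.
- by apply/measurable_EFinP; exact: measurable_normal_pdf.
- by move=> x _; rewrite lee_fin normal_pdf_ge0.
- by rewrite lee_fin /K mulr_ge0// ltW.
Qed.

(** Integrating out [z.2] first leaves [expR (s * (p + z.1) ^+ 2 / 2)] with [s = a ^+ 2], whose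
    integral is explicit. Its two factors are then bounded separately, by [expR s] and
    [expR (s * p ^+ 2)]. *)
Lemma gauss2_mgf_prod_le (a p : R) : a ^+ 2 <= 2^-1 ->
  (\int[gauss2]_z (expR (a * (p + z.1) * z.2))%:E <= (expR (a ^+ 2 * (1 + p ^+ 2)))%:E)%E.
Proof.
move=> a2; have a0 := sqr_ge0 a.
rewrite fubini_tonelli1//; last first.
  apply/measurable_EFinP; apply: measurableT_comp => //; apply: measurable_funM => //.
  by apply: measurable_funM => //; exact: measurable_funD.
rewrite /fubini_F/=.
under eq_integral do rewrite stdn_mgf exprMn.
rewrite stdn_mgf_sqr; last lra.
rewrite lee_fin; set s := a ^+ 2 in a2 a0 *.
have -> : s * (1 + p ^+ 2) = s + s * p ^+ 2 by ring.
rewrite expRD.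
have s1 : 0 < 1 - s by lra.
apply: ler_pM => //.
(* After squaring, the claim is [1 <= (1 - s) * expR (2 * s)]. It follows from
   [1 + 2 * s <= expR (2 * s)], since [(1 - s) * (1 + 2 * s) = 1 + s * (1 - 2 * s)]. *)
- rewrite -[leLHS]mulr1 ler_pdivrMl ?sqrtr_gt0//.
  rewrite -(@ler_sqr _ 1) ?nnegrE ?mulr_ge0// expr1n exprMn sqr_sqrtr ?(ltW s1)//.
  rewrite -expRM_natl; have := expR_ge1Dx (2 * s); nra.
- rewrite ler_expR -subr_ge0.
  have -> : s * p ^+ 2 - s * p ^+ 2 / (2 * (1 - s)) =
    s * p ^+ 2 * (1 - 2 * s) / (2 * (1 - s)) by field; rewrite gt_eqF.
  apply: divr_ge0; last lra.
  by apply: mulr_ge0; [rewrite mulr_ge0 ?sqr_ge0|lra].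
Qed.

End gauss2.

(** * Independent Gaussian pairs *)

(** Measurable rectangles are stable under intersection and generate the product sigma-algebra. *)
Lemma eq_measure_prod d1 d2 (T1 : measurableType d1) (T2 : measurableType d2)
    (R : realType) (m1 m2 : {measure set (T1 * T2) -> \bar R}) :
  (m1 setT < +oo)%E ->
  (forall A B, measurable A -> measurable B -> m1 (A `*` B) = m2 (A `*` B)) ->
  forall C, measurable C -> m1 C = m2 C.
Proof.
move=> m1oo m12.
pose G : set (set (T1 * T2)) := [set A `*` B | A in measurable & B in measurable].
apply: (measure_unique G (fun=> setT)) => //.
- exact: measurable_prod_measurableType.
- move=> _ _ [A1 mA1 [B1 mB1 <-]] [A2 mA2 [B2 mB2 <-]]; rewrite -setXI.
  exists (A1 `&` A2); first exact: measurableI.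
  by exists (B1 `&` B2) => //; exact: measurableI.
- by move=> _; exists setT => //; exists setT => //; rewrite setXTT.
- by rewrite bigcup_const.
- by move=> _ [A mA [B mB <-]]; exact: m12.
Qed.

Section blocks.
Context {R : realType} {d : measure_display} {T : measurableType d}.
Variable P : probability T R.
Local Open Scope ereal_scope.

(** Independence is stated for whole pairs and arbitrary measurable sets of the plane: a rotation
    mixes the two coordinates and does not preserve rectangles. *)
Definition block_iid (W : nat -> T -> R * R) :=
  (forall k, measurable_fun setT (W k)) /\
  forall (L : seq nat) (C : nat -> set (R * R)), uniq L ->
    (forall k, measurable (C k)) ->
    P (\big[setI/setT]_(k <- L) (W k @^-1` C k)) = \prod_(k <- L) gauss2 (C k).

(** For fixed [A] both sides are finite measures in [C], and they agree on rectangles. *)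
Lemma indep_pair (A : set T) (X Y : T -> R) :
  measurable A -> measurable_fun setT X -> measurable_fun setT Y ->
  (forall B1 B2, measurable B1 -> measurable B2 ->
    P (A `&` (X @^-1` B1 `&` Y @^-1` B2)) = P A * (stdn B1 * stdn B2)) ->
  forall C, measurable C ->
    P (A `&` (fun w => (X w, Y w)) @^-1` C) = P A * gauss2 C.
Proof.
move=> mA mX mY indep C mC.
have mXY : measurable_fun setT (fun w => (X w, Y w)) by exact: measurable_fun_pair.
have PAfin : P A \is a fin_num by exact: fin_num_measure.
have PA0 : (0 <= fine (P A))%R by exact: fine_ge0.
pose m1 : {measure set (R * R) -> \bar R} :=
  pushforward (mrestr P mA) (fun w => (X w, Y w)).
pose m2 : {measure set (R * R) -> \bar R} := mscale (NngNum PA0) gauss2.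
transitivity (m1 mXY C); first by rewrite setIC.
transitivity (m2 C); last by rewrite /m2/= /mscale/= fineK.
apply: eq_measure_prod => // [|B1 B2 mB1 mB2].
  by rewrite /m1/= /pushforward /mrestr preimage_setT setTI ltey_eq PAfin.
rewrite /m1 /m2/= /mscale/= /pushforward /mrestr fineK// product_measure1E//.
by rewrite -indep// setIC; congr (P (_ `&` _)).
Qed.

Lemma iid_std_normal_block (xi xis : nat -> T -> R) :
  iid_std_normal P xi xis -> block_iid (fun k w => (xi k w, xis k w)).
Proof.
move=> [mX lawX indepX].
have mxi k : measurable_fun setT (xi k) by exact: (mX (true, k)).
have mxis k : measurable_fun setT (xis k) by exact: (mX (false, k)).
have mW k : measurable_fun setT (fun w => (xi k w, xis k w)).
  exact: measurable_fun_pair.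
split => // L C uL mC.
(* Indices in [L1] carry arbitrary sets of the plane, those in [L2] only rectangles. The induction
   upgrades one index at a time; for empty [L1] the claim is the independence of the real
   variables. *)
suff main (L1 L2 : seq nat) (B1 B2 : nat -> set R) : uniq (L1 ++ L2) ->
    (forall k, measurable (B1 k)) -> (forall k, measurable (B2 k)) ->
    P ((\big[setI/setT]_(k <- L1) ((fun w => (xi k w, xis k w)) @^-1` C k)) `&`
       (\big[setI/setT]_(k <- L2) (xi k @^-1` B1 k `&` xis k @^-1` B2 k))) =
    (\prod_(k <- L1) gauss2 (C k)) * \prod_(k <- L2) (stdn (B1 k) * stdn (B2 k)).
  have := main L [::] (fun=> setT) (fun=> setT).
  by rewrite cats0 !big_nil setIT mule1; apply.
elim: L1 L2 B1 B2 => [|k L1 IH] L2 B1 B2 /= uL12 mB1 mB2.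
  rewrite !big_nil setTI mul1e !big_split/=.
  pose J := [seq (true, k) | k <- L2] ++ [seq (false, k) | k <- L2].
  have uJ : uniq J.
    rewrite cat_uniq !map_inj_uniq ?uL12//=; last 2 first.
    - by move=> x y [].
    - by move=> x y [].
    by rewrite andbT; apply/hasPn => _ /mapP[x _ ->]; apply/mapP => -[].
  have := indepX J (fun i => if i.1 then B1 i.2 else B2 i.2) uJ.
  rewrite bigcap_seq /J !big_cat/= !big_map/= => ->.
    by congr (_ * _); apply: eq_bigr => i _;
      [exact: (lawX (true, i))|exact: (lawX (false, i))].
  by move=> [[] i] /=.
move: uL12 => /andP[kL uL12].
rewrite !big_cons -setIA setIC.
set A := \big[setI/setT]_(j <- L1) _; set A' := \big[setI/setT]_(j <- L2) _.
have mA : measurable (A `&` A').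
  apply: measurableI; apply: bigsetI_measurable => j _.
    by rewrite -[X in measurable X]setTI; exact: mW.
  by apply: measurableI; rewrite -[X in measurable X]setTI; [exact: mxi|exact: mxis].
have PAE : P (A `&` A') = (\prod_(k <- L1) gauss2 (C k)) *
   \prod_(k <- L2) (stdn (B1 k) * stdn (B2 k)) by exact: IH.
rewrite indep_pair//; first by rewrite PAE muleC muleA.
move=> D1 D2 mD1 mD2.
pose B1' j := if j == k then D1 else B1 j.
pose B2' j := if j == k then D2 else B2 j.
have kL2 : k \notin L2 by move: kL; rewrite mem_cat negb_or => /andP[].
have nk j : j \in L2 -> (j == k) = false.
  by move=> jL2; apply/negbTE; apply: contraNneq kL2 => <-.
have A'E : \big[setI/setT]_(j <- L2) (xi j @^-1` B1' j `&` xis j @^-1` B2' j) = A'.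
  by apply: eq_big_seq => j /nk jk; rewrite /B1' /B2' jk.
have BE : \prod_(j <- L2) (stdn (B1' j) * stdn (B2' j)) =
    \prod_(j <- L2) (stdn (B1 j) * stdn (B2 j)).
  by apply: eq_big_seq => j /nk jk; rewrite /B1' /B2' jk.
have := IH (k :: L2) B1' B2'.
have [Bk1 Bk2] : B1' k = D1 /\ B2' k = D2 by rewrite /B1' /B2' eqxx.
rewrite !big_cons A'E BE Bk1 Bk2 PAE => IHk.
rewrite -setIA [A' `&` _]setIC IHk.
- by rewrite -[RHS]muleA; congr (_ * _); rewrite muleC.
- by rewrite (perm_uniq (permEl (perm_catCA L1 [:: k] L2)))/= kL.
- by move=> j; rewrite /B1'; case: ifP.
- by move=> j; rewrite /B2'; case: ifP.
Qed.

Lemma block_iid_rot (W : nat -> T -> R * R) (c s : nat -> R) :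
  (forall k, (c k ^+ 2 + s k ^+ 2 = 1)%R) -> block_iid W ->
  block_iid (fun k w => rot (c k) (s k) (W k w)).
Proof.
move=> cs [mW WC]; split => [k|L C uL mC].
  by apply: measurableT_comp => //; exact: measurable_rot.
transitivity (\prod_(k <- L) gauss2 (rot (c k) (s k) @^-1` C k)).
  apply: (WC L (fun k => rot (c k) (s k) @^-1` C k)) => // k.
  by rewrite -[X in measurable X]setTI; exact: measurable_rot.
by apply: eq_bigr => k _; rewrite gauss2_rot.
Qed.

End blocks.

Lemma ge0_integral_mrestr d (T : measurableType d) (R : realType)
    (mu : {measure set T -> \bar R}) (D : set T) (mD : measurable D)
    (g : T -> \bar R) :
  (forall x, 0 <= g x)%E -> measurable_fun setT g ->
  (\int[mrestr mu mD]_x g x = \int[mu]_(x in D) g x)%E.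
Proof.
move=> g0 mg; rewrite (@ge0_integral_density _ _ _ mu _ (\1_D))//.
- rewrite [RHS]integral_mkcond; apply: eq_integral => x _.
  by rewrite patchE indicE; case: ifP => _; rewrite ?mule1 ?mule0.
- by move=> A mA; rewrite integral_indic// setIC.
Qed.

(** * Sigma-algebras generated by cylinders with one restricted coordinate *)

Section cylinders.
Context {R : realType} {d : measure_display} {T : measurableType d}.
Variables (P : probability T R) (W : nat -> T -> R * R).
Hypothesis WP : block_iid P W.
Local Open Scope ereal_scope.

Let mW k : measurable_fun setT (W k). Proof. by case: WP. Qed.

Let cyl_of (C : nat -> set (R * R)) : set T := [set w | forall j, C j (W j w)].

Let cyl_ofE (C : nat -> set (R * R)) n : (forall j, (n <= j)%N -> C j = setT) ->
  cyl_of C = \big[setI/setT]_(j <- iota 0 n) (W j @^-1` C j).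
Proof.
move=> Cn; rewrite -bigcap_seq; apply/seteqP; split => w.
  by move=> Cw j _; exact: Cw.
move=> Cw j; have [jn|nj] := ltnP j n; last by rewrite Cn.
by apply: (Cw j) => /=; rewrite mem_iota.
Qed.

Let prob_cyl_of C n : (forall j, measurable (C j)) ->
  (forall j, (n <= j)%N -> C j = setT) ->
  P (cyl_of C) = \prod_(j <- iota 0 n) gauss2 (C j).
Proof.
move=> mC Cn; rewrite (cyl_ofE Cn).
by have [_ ->] := WP; rewrite ?iota_uniq.
Qed.

(** The class [CC] limits what may be observed of block [k]: nothing at all for [[set setT]],
    everything but the sign of the second coordinate for the flip-invariant sets. *)
Definition cylinders (k : nat) (CC : set (set (R * R))) : set (set T) :=
  [set A | exists C n, [/\ (forall j, measurable (C j)), CC (C k),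
    (forall j, (n <= j)%N -> C j = setT) & A = [set w | forall j, C j (W j w)]]].

Lemma cylinders_measurable k CC : cylinders k CC `<=` measurable.
Proof.
move=> _ [C [n [mC _ Cn ->]]]; rewrite -/(cyl_of C) (cyl_ofE Cn).
by apply: bigsetI_measurable => j _; rewrite -[X in measurable X]setTI; exact: mW.
Qed.

Lemma cylinders_other k CC j D : CC setT -> j != k -> measurable D ->
  cylinders k CC (W j @^-1` D).
Proof.
move=> CCT jk mD; exists (fun i => if i == j then D else setT), j.+1; split.
- by move=> i; case: ifP.
- by rewrite eq_sym (negbTE jk).
- by move=> i ji; rewrite gtn_eqF.
- apply/seteqP; split => w /=; first by move=> Dw i; case: eqVneq => // ->.
  by move=> /(_ j); rewrite eqxx.
Qed.

Lemma cylinders_self k (CC : set (set (R * R))) D : CC D -> measurable D ->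
  cylinders k CC (W k @^-1` D).
Proof.
move=> CCD mD; exists (fun i => if i == k then D else setT), k.+1; split.
- by move=> i; case: ifP.
- by rewrite eqxx.
- by move=> i ji; rewrite gtn_eqF.
- apply/seteqP; split => w /=; first by move=> Dw i; case: eqVneq => // ->.
  by move=> /(_ k); rewrite eqxx.
Qed.

Section dynkin.
Variables (k : nat) (CC : set (set (R * R))).
Hypotheses (CCT : CC setT) (CCI : setI_closed CC).
Variables (D1 D2 : set (R * R)) (c : {nonneg R}).
Hypotheses (mD1 : measurable D1) (mD2 : measurable D2).
Hypothesis gaussD : forall D, CC D -> measurable D ->
  gauss2 (D `&` D1) = c%:num%:E * gauss2 (D `&` D2).

Let mWD D : measurable D -> measurable (W k @^-1` D).
Proof. by move=> mD; rewrite -[X in measurable X]setTI; exact: mW. Qed.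

Let prob_cylI C n D : (forall j, measurable (C j)) -> measurable D ->
  (forall j, (n <= j)%N -> C j = setT) ->
  P (cyl_of C `&` W k @^-1` D) = gauss2 (C k `&` D) *
    \prod_(j <- iota 0 (maxn n k.+1) | j != k) gauss2 (C j).
Proof.
move=> mC mD Cn.
pose C' j := if j == k then C k `&` D else C j.
have -> : cyl_of C `&` W k @^-1` D = cyl_of C'.
  apply/seteqP; split => w; rewrite /cyl_of /C'/=.
    by move=> [Cw Dw] j; case: eqVneq => // ->.
  move=> Cw; split; last by have := Cw k; rewrite eqxx => -[].
  by move=> j; have := Cw j; case: eqVneq => // -> [].
(* The bound [maxn n k.+1] keeps [k] in the product even when the cylinder itself stops before
   [k]. *)
rewrite (@prob_cyl_of C' (maxn n k.+1)).
- have kn : k \in iota 0 (maxn n k.+1) by rewrite mem_iota/= leq_max ltnSn orbT.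
  rewrite (bigD1_seq k kn (iota_uniq _ _)) {1}/C' eqxx; congr (_ * _).
  by apply: eq_bigr => j /negbTE jk; rewrite /C' jk.
- by move=> j; rewrite /C'; case: ifP => // _; exact: measurableI.
- move=> j; rewrite geq_max => /andP[nj kj]; rewrite /C' gtn_eqF//; exact: Cn.
Qed.

(** Both sides are finite measures in [A]. Cylinders are stable under intersection because [CC] is,
    and on a cylinder the product formula isolates factor [k], where [gaussD] applies. *)
Lemma prob_sigma_cylinders A : <<s cylinders k CC >> A ->
  P (A `&` W k @^-1` D1) = c%:num%:E * P (A `&` W k @^-1` D2).
Proof.
move=> sA.
pose m1 : {measure set T -> \bar R} := mrestr P (mWD mD1).
pose m2 : {measure set T -> \bar R} := mscale c (mrestr P (mWD mD2)).
transitivity (m1 A) => //; transitivity (m2 A) => //.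
apply: (g_sigma_algebra_measure_unique (cylinders k CC) _ (fun=> setT)) => //.
- exact: cylinders_measurable.
- move=> _; exists (fun=> setT), 0%N; split => //.
  by apply/seteqP; split.
- by rewrite bigcup_const.
- move=> _ _ [C [n [mC CCk Cn ->]]] [C' [n' [mC' CCk' Cn' ->]]].
  exists (fun j => C j `&` C' j), (maxn n n'); split.
  + by move=> j; exact: measurableI.
  + exact: CCI.
  + by move=> j; rewrite geq_max => /andP[nj n'j]; rewrite Cn// Cn'// setIT.
  + apply/seteqP; split => w /=; first by move=> [Cw C'w] j.
    by move=> Cw; split => j; case: (Cw j).
- move=> _ [C [n [mC CCk Cn ->]]]; rewrite /m1 /m2/= /mscale/= /mrestr.
  by rewrite !(prob_cylI mC _ Cn)// gaussD// muleA.
- by move=> _; rewrite /m1/= /mrestr setTI ltey_eq fin_num_measure//; exact: mWD.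
Qed.

Lemma integral_sigma_cylinders (Z : T -> R) : (forall w, (0 <= Z w)%R) ->
  measurable_fun [set: g_sigma_algebraType (cylinders k CC)] Z ->
  \int[P]_(w in W k @^-1` D1) (Z w)%:E =
  c%:num%:E * \int[P]_(w in W k @^-1` D2) (Z w)%:E.
Proof.
move=> Z0 mZ.
have sZ B : measurable B -> <<s cylinders k CC >> (Z @^-1` B).
  by move=> mB; rewrite -[Z @^-1` B]setTI; exact: mZ.
have mZT : measurable_fun [set: T] Z.
  move=> _ B mB; rewrite setTI; move: (sZ B mB).
  by apply: smallest_sub; [exact: sigma_algebra_measurable|exact: cylinders_measurable].
(* The two restricted laws of [Z] are proportional, which settles the integrals. The absolute value
   makes the integrand nonnegative on the whole line and changes nothing, as [Z] is nonnegative. *)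
have law D (mD : measurable D) : \int[P]_(w in W k @^-1` D) (Z w)%:E =
    \int[pushforward (mrestr P (mWD mD)) Z]_y (`|y|)%:E.
  rewrite ge0_integral_pushforward//=.
  - rewrite preimage_setT ge0_integral_mrestr//.
    + by apply: eq_integral => w _; rewrite ger0_norm.
    + apply/measurable_EFinP; exact: measurableT_comp.
  - by apply: measurableT_comp => //; exact: normr_measurable.
rewrite !law -ge0_integral_mscale//=; last first.
  by apply: measurableT_comp => //; exact: normr_measurable.
apply: eq_measure_integral => B mB _.
by rewrite /mscale/= /pushforward/= /mrestr prob_sigma_cylinders//; exact: sZ.
Qed.

End dynkin.

End cylinders.

(** Independence makes the joint law of [Z] and [Y] the product of their laws, and Tonelli separates
    the integral. *)
Lemma ge0_integral_indep d (T : measurableType d) (R : realType)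
    (P : probability T R) (Z Y : T -> R) :
  (forall w, 0 <= Z w) -> (forall w, 0 <= Y w) ->
  measurable_fun setT Z -> measurable_fun setT Y ->
  (forall A B, measurable A -> measurable B ->
    P (Z @^-1` A `&` Y @^-1` B) = P (Z @^-1` A) * P (Y @^-1` B))%E ->
  (\int[P]_w (Z w * Y w)%:E = \int[P]_w (Z w)%:E * \int[P]_w (Y w)%:E)%E.
Proof.
move=> Z0 Y0 mZ mY indep.
pose Z' : {RV P >-> R} := HB.pack Z (isMeasurableFun.Build _ _ _ _ Z mZ).
pose Y' : {RV P >-> R} := HB.pack Y (isMeasurableFun.Build _ _ _ _ Y mY).
have mZY : measurable_fun setT (fun w => (Z w, Y w)) by exact: measurable_fun_pair.
have mnorm : measurable_fun setT (fun y : R => (`|y|)%:E).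
  by apply: measurableT_comp => //; exact: normr_measurable.
have law (X : {RV P >-> R}) : (forall w, 0 <= X w) ->
    (\int[P]_w (X w)%:E = \int[distribution P X]_y (`|y|)%:E)%E.
  move=> X0; rewrite ge0_integral_pushforward//= preimage_setT.
  by apply: eq_integral => w _; rewrite ger0_norm.
have mn2 : measurable_fun setT (fun z : R * R => (`|z.1| * `|z.2|)%:E).
  by apply/measurable_EFinP; apply: measurable_funM; apply: measurableT_comp => //;
    exact: normr_measurable.
transitivity (\int[pushforward P (fun w => (Z w, Y w))]_z (`|z.1| * `|z.2|)%:E)%E.
  rewrite ge0_integral_pushforward//= ?preimage_setT.
  by apply: eq_integral => w _; rewrite !ger0_norm.
transitivity (\int[distribution P Z' \x distribution P Y']_z (`|z.1| * `|z.2|)%:E)%E.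
  apply: eq_measure_integral => C mC _; apply/esym.
  by apply: product_measure_unique => // A B mA mB; rewrite -indep.
rewrite fubini_tonelli1//.
rewrite (law Z' Z0) (law Y' Y0) /fubini_F -ge0_integralZr//; last first.
  exact: integral_ge0.
by apply: eq_integral => x _; rewrite -ge0_integralZl.
Qed.

(** * Expectations of products over independent blocks *)

Section products.
Context {R : realType} {d : measure_display} {T : measurableType d}.
Variables (P : probability T R) (W : nat -> T -> R * R).
Hypothesis WP : block_iid P W.
Local Open Scope ereal_scope.

Lemma measurable_cylinders_other k CC j (g : R * R -> R) : CC setT -> j != k ->
  measurable_fun setT g ->
  measurable_fun [set: g_sigma_algebraType (cylinders W k CC)] (g \o W j).
Proof.
move=> CCT jk mg _ B mB; rewrite setTI; apply: sub_sigma_algebra.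
rewrite comp_preimage; apply: cylinders_other => //.
by rewrite -[X in measurable X]setTI; exact: mg.
Qed.

Lemma ge0_integral_prod_blocks (g : nat -> R * R -> R) n :
  (forall j z, (0 <= g j z)%R) -> (forall j, measurable_fun setT (g j)) ->
  \int[P]_w (\prod_(j < n) g j (W j w))%:E =
  \prod_(j < n) \int[gauss2]_z (g j z)%:E.
Proof.
move=> g0 mg; have [mW _] := WP.
elim: n => [|n IH].
  rewrite big_ord0; under eq_integral do rewrite big_ord0.
  rewrite integral_cst// mul1e.
  exact: probability_setT.
rewrite big_ord_recr/= -IH.
have mgW j : measurable_fun setT (g j \o W j) by exact: measurableT_comp.
have mZ : measurable_fun [set: g_sigma_algebraType (cylinders W n [set setT])]
    (fun w => \prod_(j < n) g j (W j w))%R.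
  apply: measurable_prod => j _; apply: measurable_cylinders_other => //.
  by rewrite neq_ltn ltn_ord.
have gE D : measurable D -> P (W n @^-1` D) = gauss2 D.
  move=> mD; have := WP.2 [:: n] (fun=> D).
  by rewrite !big_seq1; apply.
under eq_integral do rewrite big_ord_recr/=.
rewrite (@ge0_integral_indep _ _ _ _ _ (g n \o W n))//.
- congr (_ * _).
  transitivity (\int[pushforward P (W n)]_z (g n z)%:E).
    rewrite ge0_integral_pushforward//= ?preimage_setT//.
    - exact/measurable_EFinP.
    - by move=> z _; rewrite lee_fin.
  by apply: eq_measure_integral => D mD _; exact: gE.
- by move=> w; apply: prodr_ge0.
- by move=> w; exact: g0.
- by apply: measurable_prod => j _; exact: mgW.
- move=> A B mA mB.
  have mgB : measurable (g n @^-1` B).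
    by rewrite -[X in measurable X]setTI; exact: mg.
  have c0 : (0 <= fine (gauss2 (g n @^-1` B)))%R by exact: fine_ge0.
  have cE : (fine (gauss2 (g n @^-1` B)))%:E = gauss2 (g n @^-1` B).
    by rewrite fineK// fin_num_measure.
  rewrite comp_preimage gE// muleC -cE.
  set A' := (_ @^-1` A).
  have -> : P A' = P (A' `&` W n @^-1` setT) by rewrite preimage_setT setIT.
  apply: (@prob_sigma_cylinders _ _ _ P W WP n [set setT] _ _ _ _ (NngNum c0)) => //.
  - by move=> _ _ -> ->; rewrite setIT.
  - by move=> D -> _; rewrite /= !setTI cE [X in _ * X](@probability_setT _ _ _ gauss2) mule1.
  - by rewrite -[A']setTI; exact: mZ.
Qed.

End products.

(** * Sign symmetrization *)

Section flip.
Context {R : realType}.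
Notation mu := (@lebesgue_measure R).
Notation phi := (normal_pdf (0 : R) 1).

Definition flip (z : R * R) : R * R := (z.1, - z.2).

Lemma measurable_flip : measurable_fun setT flip.
Proof. by apply: measurable_fun_pair => //; exact: measurableT_comp. Qed.

Lemma gauss2_flip C : measurable C -> gauss2 (flip @^-1` C) = gauss2 C.
Proof.
move=> mC.
have mfC : measurable (flip @^-1` C).
  by rewrite -[X in measurable X]setTI; exact: measurable_flip.
rewrite (gauss2E mfC) (gauss2E mC); apply: eq_integral => x _.
pose F y := ((\1_C (x, y))%:E * (phi x * phi y)%:E)%E.
transitivity (\int[mu]_y F (- 1 * y + 0)%R)%E.
  apply: eq_integral => y _; rewrite /F addr0 mulN1r; congr (_ * _)%E.
  by rewrite !normal_pdfE ?oner_neq0// /normal_fun !subr0 sqrrN.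
rewrite ge0_integral_affine ?oppr_eq0 ?oner_neq0//.
- by rewrite normrN normr1 invr1 mul1e.
- apply: emeasurable_funM; apply/measurable_EFinP.
    by apply: measurableT_comp => //; exact: measurable_pair1.
  by apply: measurable_funM => //; exact: measurable_normal_pdf.
- by move=> y; rewrite mule_ge0// lee_fin// mulr_ge0// normal_pdf_ge0.
Qed.

Definition flip_invariant : set (set (R * R)) := [set D | flip @^-1` D = D].

Lemma flip_invariantT : flip_invariant setT. Proof. by []. Qed.

Lemma flip_invariantI : setI_closed flip_invariant.
Proof. by move=> A B sA sB; rewrite /flip_invariant/= preimage_setI sA sB. Qed.

End flip.

(** This is the monotonicity of cosh in [|t|]. For [t >= 0], with [a = expR (h * t)] and
    [b = expR t], the difference is [(b - a) * (a * b - 1) / (a * b)], where [1 <= a <= b]. *)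
Lemma expR_cosh_le (R : realType) (h t : R) : 0 <= h <= 1 ->
  expR (h * t) + expR (- (h * t)) <= expR t + expR (- t).
Proof.
move=> /andP[h0 h1].
wlog t0 : t / 0 <= t => [W|].
  have [|t0] := leP 0 t; first exact: W.
  have tN : 0 <= - t by lra.
  by have := W _ tN; rewrite mulrN !opprK; lra.
have ht0 : 0 <= h * t by rewrite mulr_ge0.
have htt : h * t <= t by rewrite ler_piMl.
rewrite !expRN; set a := expR (h * t); set b := expR t.
have a1 : 1 <= a by rewrite -expR0 ler_expR.
have ab : a <= b by rewrite ler_expR.
have a0 : 0 < a by exact: expR_gt0.
have b0 : 0 < b by exact: expR_gt0.
rewrite -subr_ge0 (_ : _ - _ = (b - a) * (a * b - 1) / (a * b)); last first.
  by field; rewrite !gt_eqF.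
rewrite divr_ge0 ?mulr_ge0 ?(ltW a0) ?(ltW b0)//; nra.
Qed.

Section symmetrization.
Context {R : realType} {d : measure_display} {T : measurableType d}.
Variables (P : probability T R) (W : nat -> T -> R * R).
Hypothesis WP : block_iid P W.
Local Open Scope ereal_scope.

Notation sym_algebra k := (cylinders W k flip_invariant).

Lemma measurable_cylinders_flip k (g : R * R -> R) :
  (forall z, g (flip z) = g z) -> measurable_fun setT g ->
  measurable_fun [set: g_sigma_algebraType (sym_algebra k)] (g \o W k).
Proof.
move=> gs mg _ B mB; rewrite setTI; apply: sub_sigma_algebra.
rewrite comp_preimage; apply: cylinders_self.
  by rewrite /flip_invariant/=; apply/seteqP; split => z /=; rewrite gs.
by rewrite -[X in measurable X]setTI; exact: mg.
Qed.

Let pos : set (R * R) := [set z | (0 < z.2)%R].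
Let neg : set (R * R) := [set z | (z.2 < 0)%R].
Let zer : set (R * R) := [set z | z.2 = 0%R].

Let mpos : measurable pos.
Proof.
rewrite (_ : pos = setT `&` snd @^-1` `]0%R, +oo[%classic).
  exact: measurable_snd.
by apply/seteqP; split => z /=; rewrite in_itv/= andbT; tauto.
Qed.
Let mneg : measurable neg.
Proof.
rewrite (_ : neg = setT `&` snd @^-1` `]-oo, 0%R[%classic).
  exact: measurable_snd.
by apply/seteqP; split => z /=; rewrite in_itv/=; tauto.
Qed.
Let mzer : measurable zer.
Proof.
rewrite (_ : zer = setT `&` snd @^-1` [set 0%R]); first exact: measurable_snd.
by apply/seteqP; split => z /=; tauto.
Qed.

(** The reflection exchanges [pos] and [neg], preserves the Gaussian law and fixes the sets allowed
    for block [k], so the proportionality constant is [1]. *)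
Let integral_pos_neg k (Z : T -> R) : (forall w, (0 <= Z w)%R) ->
  measurable_fun [set: g_sigma_algebraType (sym_algebra k)] Z ->
  \int[P]_(w in W k @^-1` pos) (Z w)%:E = \int[P]_(w in W k @^-1` neg) (Z w)%:E.
Proof.
move=> Z0 mZ; rewrite -[RHS]mul1e.
apply: (@integral_sigma_cylinders _ _ _ P W WP k flip_invariant
  flip_invariantT flip_invariantI _ _ (1%:nng)%R) => // D sD mD.
rewrite mul1e -[RHS]gauss2_flip; last exact: measurableI.
congr (gauss2 _); rewrite preimage_setI sD; congr (_ `&` _).
by apply/seteqP; split => z; rewrite /pos /neg /flip/= oppr_lt0.
Qed.

Lemma measurable_of_sym_algebra k (Z : T -> R) :
  measurable_fun [set: g_sigma_algebraType (sym_algebra k)] Z ->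
  measurable_fun setT Z.
Proof.
move=> mZ _ B mB; move: (mZ measurableT B mB).
by apply: smallest_sub; [exact: sigma_algebra_measurable|exact: (cylinders_measurable WP)].
Qed.

(** The part over [neg] is folded onto [pos], which produces twice a cosh. The part over [zer] stays
    as a separate term that does not depend on [c]. *)
Let integral_exp_split k (c G : T -> R) : (forall w, (0 <= G w)%R) ->
  measurable_fun [set: g_sigma_algebraType (sym_algebra k)] c ->
  measurable_fun [set: g_sigma_algebraType (sym_algebra k)] G ->
  \int[P]_w (expR (c w * (W k w).2) * G w)%:E =
  \int[P]_(w in W k @^-1` pos)
     ((expR (c w * `|(W k w).2|) + expR (- (c w * `|(W k w).2|))) * G w)%:E +
  \int[P]_(w in W k @^-1` zer) (G w)%:E.
Proof.
move=> G0 mc mG; have [mW _] := WP.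
have mWD D : measurable D -> measurable (W k @^-1` D).
  by move=> mD; rewrite -[X in measurable X]setTI; exact: mW.
have mabs : measurable_fun [set: g_sigma_algebraType (sym_algebra k)]
    (fun w => `|(W k w).2|)%R.
  apply: (@measurable_cylinders_flip k (fun z => `|z.2|)%R) => [z|].
    by rewrite /flip/= normrN.
  by apply: measurableT_comp => //; exact: normr_measurable.
have mE1 : measurable_fun [set: g_sigma_algebraType (sym_algebra k)]
    (fun w => expR (c w * `|(W k w).2|) * G w)%R.
  apply: measurable_funM => //; apply: measurableT_comp => //.
  exact: measurable_funM.
have mE2 : measurable_fun [set: g_sigma_algebraType (sym_algebra k)]
    (fun w => expR (- (c w * `|(W k w).2|)) * G w)%R.
  apply: measurable_funM => //; apply: measurableT_comp => //.
  by apply: measurableT_comp => //; exact: measurable_funM.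
have mcT := measurable_of_sym_algebra mc; have mGT := measurable_of_sym_algebra mG.
have mE1T := measurable_of_sym_algebra mE1; have mE2T := measurable_of_sym_algebra mE2.
have mE : measurable_fun setT (fun w => expR (c w * (W k w).2) * G w)%R.
  apply: measurable_funM => //; apply: measurableT_comp => //.
  by apply: measurable_funM => //; exact: measurableT_comp.
have E0 w : (0 <= expR (c w * (W k w).2) * G w)%R by rewrite mulr_ge0 ?expR_ge0.
have TE : [set: T] = W k @^-1` pos `|` W k @^-1` neg `|` W k @^-1` zer.
  apply/seteqP; split => // w _ /=; rewrite /pos /neg /zer/=.
  by have [w0|w0|w0] := ltgtP (W k w).2 0%R; [left; right|left; left|right].
rewrite TE ge0_integral_setU//=; last 5 first.
- by apply: measurableU; exact: mWD.
- exact: mWD.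
- by apply/measurable_EFinP; exact: measurable_funTS.
- by move=> w _; rewrite lee_fin.
- by apply/disj_setPS => w /= [[]]; rewrite /pos /neg /zer/= => + H; rewrite H ltxx.
rewrite ge0_integral_setU//=; last 5 first.
- exact: mWD.
- exact: mWD.
- by apply/measurable_EFinP; exact: measurable_funTS.
- by move=> w _; rewrite lee_fin.
- by apply/disj_setPS => w /= []; rewrite /pos /neg/= => /lt_trans h /h; rewrite ltxx.
congr (_ + _); last first.
  apply: eq_integral => w; rewrite inE /zer/= => ->.
  by rewrite mulr0 expR0 mul1r.
under [RHS]eq_integral do rewrite mulrDl EFinD.
rewrite [RHS]ge0_integralD//=; last 5 first.
- exact: mWD.
- by move=> w _; rewrite lee_fin mulr_ge0 ?expR_ge0.
- by apply/measurable_EFinP; exact: measurable_funTS.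
- by move=> w _; rewrite lee_fin mulr_ge0 ?expR_ge0.
- by apply/measurable_EFinP; exact: measurable_funTS.
congr (_ + _).
  by apply: eq_integral => w; rewrite inE /pos/= => w0; rewrite gtr0_norm.
rewrite integral_pos_neg//; last by move=> w; rewrite mulr_ge0 ?expR_ge0.
by apply: eq_integral => w; rewrite inE /neg/= => w0; rewrite ltr0_norm// mulrN opprK.
Qed.

(** Once both sides are split by sign, the terms over [zer] coincide and those over [pos] compare
    pointwise. All of [h], [c] and [G] may be random, provided they do not see the sign of the
    second coordinate of block [k]. *)
Lemma symmetrization_step k (h c G : T -> R) : (forall w, (0 <= G w)%R) ->
  (forall w, (0 <= h w <= 1)%R) ->
  measurable_fun [set: g_sigma_algebraType (sym_algebra k)] h ->
  measurable_fun [set: g_sigma_algebraType (sym_algebra k)] c ->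
  measurable_fun [set: g_sigma_algebraType (sym_algebra k)] G ->
  \int[P]_w (expR (h w * c w * (W k w).2) * G w)%:E <=
  \int[P]_w (expR (c w * (W k w).2) * G w)%:E.
Proof.
move=> G0 h01 mh mc mG; have [mW _] := WP.
have mhc := measurable_funM mh mc.
rewrite (integral_exp_split G0 mc mG) (integral_exp_split G0 mhc mG).
apply: leeD2r.
have mcT := measurable_of_sym_algebra mc; have mGT := measurable_of_sym_algebra mG.
have mhcT := measurable_of_sym_algebra mhc.
have mabs : measurable_fun setT (fun w => `|(W k w).2|)%R.
  by apply: measurableT_comp => //; exact: measurableT_comp.
have mI (c' : T -> R) : measurable_fun setT c' -> measurable_fun (W k @^-1` pos)
    (fun w => ((expR (c' w * `|(W k w).2|) + expR (- (c' w * `|(W k w).2|))) * G w)%:E).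
  move=> mc'; apply: measurable_funTS; apply/measurable_EFinP.
  apply: measurable_funM => //; apply: measurable_funD; apply: measurableT_comp => //.
    exact: measurable_funM.
  by apply: measurableT_comp => //; exact: measurable_funM.
apply: ge0_le_integral.
- by rewrite -[X in measurable X]setTI; exact: mW.
- by move=> w _; rewrite lee_fin mulr_ge0 ?addr_ge0 ?expR_ge0.
- exact: mI.
- exact: mI.
- by move=> w _; rewrite lee_fin ler_wpM2r// -mulrA expR_cosh_le.
Qed.

End symmetrization.

(** * The moment generating function of the weighted sum *)

Section mgf.
Context {R : realType} {d : measure_display} {T : measurableType d}.
Variables (P : probability T R) (W : nat -> T -> R * R).
Hypothesis WP : block_iid P W.
Variables (h : T -> nat -> R) (c p : nat -> R) (n : nat).
Hypothesis h01 : forall w k, 0 <= h w k <= 1.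
Hypothesis mh : forall m k, measurable_fun
  [set: g_sigma_algebraType (cylinders W m flip_invariant)] (fun w => h w k).
Local Open Scope ereal_scope.

(* Replacing the weights by [1] one coordinate at a time. *)
Let weight m w k : R := if (k < m)%N then 1%R else h w k.
Let term k w : R := (c k * (p k + (W k w).1))%R.

Let Eweight m :=
  \int[P]_w (expR (\sum_(k < n) weight m w k * term k w * (W k w).2)%R)%:E.

Let Eweight_le m : (m < n)%N -> Eweight m <= Eweight m.+1.
Proof.
move=> mn.
(* All coordinates except [m]. Their weights may depend on block [m], but not on the sign of its
   second coordinate. *)
pose G w := expR (\sum_(k < n | k != Ordinal mn)
  weight m w k * term k w * (W k w).2)%R.
have E1 : Eweight m = \int[P]_w (expR (h w m * term m w * (W m w).2) * G w)%:E.
  apply: eq_integral => w _; rewrite (bigD1 (Ordinal mn))//= expRD.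
  by rewrite {1}/weight ltnn.
have E2 : Eweight m.+1 = \int[P]_w (expR (term m w * (W m w).2) * G w)%:E.
  apply: eq_integral => w _; rewrite (bigD1 (Ordinal mn))//= expRD.
  rewrite {1}/weight ltnSn mul1r; congr (_ * expR _)%:E.
  apply: eq_bigr => k km; rewrite /weight ltnS leq_eqVlt.
  by move: km; rewrite -val_eqE/= => /negbTE ->.
rewrite E1 E2; apply: symmetrization_step => //.
- by move=> w; exact: expR_ge0.
- apply: (@measurable_cylinders_flip _ _ _ _ m (fun z => c m * (p m + z.1))%R) => //.
  by apply: measurable_funM => //; exact: measurable_funD.
- apply: measurableT_comp => //.
  under eq_fun do rewrite big_mkcond/=.
  apply: measurable_sum => k.
  case: eqVneq => [_|km]/=; first exact: measurable_cst.
  rewrite -val_eqE/= in km.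
  under eq_fun do rewrite -mulrA.
  apply: measurable_funM.
    by rewrite /weight; case: (k < m)%N => //; exact: measurable_cst.
  apply: (@measurable_cylinders_other _ _ _ _ m _ k
    (fun z => c k * (p k + z.1) * z.2)%R) => //.
  by apply: measurable_funM => //; apply: measurable_funM => //; exact: measurable_funD.
Qed.

Lemma mgf_weighted_le : (forall k, (c k ^+ 2 <= 2^-1)%R \/ (n <= k)%N) ->
  \int[P]_w (expR (\sum_(k < n) h w k * (c k * (p k + (W k w).1)) * (W k w).2)%R)%:E
  <= (expR (\sum_(k < n) c k ^+ 2 * (1 + p k ^+ 2))%R)%:E.
Proof.
move=> c2.
have Eweight_mono m : (m <= n)%N -> Eweight 0 <= Eweight m.
  elim: m => [//|m IH] mn.
  exact: le_trans (IH (ltnW mn)) (Eweight_le mn).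
have -> : \int[P]_w (expR (\sum_(k < n) h w k * (c k * (p k + (W k w).1)) *
    (W k w).2)%R)%:E = Eweight 0 by [].
apply: (le_trans (Eweight_mono _ (leqnn n))).
pose g k (z : R * R) := expR (c k * (p k + z.1) * z.2)%R.
have -> : Eweight n = \int[P]_w (\prod_(k < n) g k (W k w))%:E.
  apply: eq_integral => w _; rewrite expR_sum; congr EFin.
  by apply: eq_bigr => k _; rewrite /weight ltn_ord mul1r.
rewrite (ge0_integral_prod_blocks WP); last 2 first.
- by move=> k z; exact: expR_ge0.
- move=> k; apply: measurableT_comp => //; apply: measurable_funM => //.
  by apply: measurable_funM => //; exact: measurable_funD.
rewrite expR_sum.
(* Independence has been used up; only a comparison of two products, factor by factor, is left. *)
elim: (n) c2 => [|m IH] c2; first by rewrite !big_ord0.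
rewrite !big_ord_recr [leRHS]EFinM; apply: lee_pmul.
- by apply: prode_ge0 => k _; apply: integral_ge0 => z _; rewrite lee_fin expR_ge0.
- by apply: integral_ge0 => z _; rewrite lee_fin expR_ge0.
- by apply: IH => k; case: (c2 k) => [|mk]; [left|right; exact: ltnW].
- by apply: gauss2_mgf_prod_le; case: (c2 m) => //; rewrite ltnn.
Qed.

End mgf.

(** The indicator of the event is at most [expR (- (l * t)) * (expR (l * Y w) + expR (- l * Y w))];
    the two exponentials account for the factor 2. *)
Lemma chernoff2 d (T : measurableType d) (R : realType) (P : probability T R)
    (Y : T -> R) (l t K : R) : 0 <= l -> measurable_fun setT Y ->
  (\int[P]_w (expR (l * Y w))%:E <= K%:E)%E ->
  (\int[P]_w (expR (- l * Y w))%:E <= K%:E)%E ->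
  (P [set w | (t < `|Y w|)%R] <= (2 * (expR (- (l * t)) * K))%:E)%E.
Proof.
move=> l0 mY K1 K2.
have mE a : measurable_fun setT (fun w => expR (a * Y w)).
  by apply: measurableT_comp => //; exact: measurable_funM.
have mA : measurable [set w | (t < `|Y w|)%R].
  rewrite (_ : [set w | _] = setT `&` (fun w => `|Y w|) @^-1` `]t, +oo[%classic).
    by apply: measurableT_comp => //; exact: normr_measurable.
  by apply/seteqP; split => w /=; rewrite in_itv/= andbT; tauto.
rewrite -[X in P X]setIT -integral_indic//.
pose F w := (expR (- (l * t)) * (expR (l * Y w) + expR (- l * Y w))).
apply: (@le_trans _ _ (\int[P]_w (F w)%:E)%E).
  apply: ge0_le_integral => //.
  - exact/measurable_EFinP.
  - apply/measurable_EFinP; apply: measurable_funM => //.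
    exact: measurable_funD.
  move=> w _; rewrite lee_fin indicE; case: (boolP (_ \in _)) => [|_]; last first.
    by rewrite mulr_ge0 ?addr_ge0 ?expR_ge0.
  rewrite inE/= => tY; rewrite /F mulrDr -!expRD.
  have [Y0|Y0] := leP 0 (Y w).
  + rewrite ger0_norm// in tY; apply: (@le_trans _ _ (expR (- (l * t) + l * Y w))).
      by rewrite -expR0 ler_expR; nra.
    by rewrite lerDl expR_ge0.
  + rewrite ltr0_norm// in tY; apply: (@le_trans _ _ (expR (- (l * t) + - l * Y w))).
      by rewrite -expR0 ler_expR; nra.
    by rewrite lerDr expR_ge0.
under eq_integral do rewrite /F EFinM EFinD.
rewrite ge0_integralZl//; last 2 first.
- by apply: emeasurable_funD; exact/measurable_EFinP.
- by move=> w _; rewrite -EFinD lee_fin addr_ge0 ?expR_ge0.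
rewrite ge0_integralD//; last 2 first.
- exact/measurable_EFinP.
- exact/measurable_EFinP.
rewrite mulrCA EFinM lee_pmul2l ?lte_fin ?expR_gt0// mulr_natl mulr2n EFinD.
exact: leeD.
Qed.

(** * The derivative of the criterion *)

Section criterion.
Context {R : realType}.

Lemma is_derive_bigsum (I : Type) (r : seq I) (F : I -> R -> R) (dF : I -> R) (t : R) :
  (forall i, is_derive t 1 (F i) (dF i)) ->
  is_derive t 1 (fun u => \sum_(i <- r) F i u) (\sum_(i <- r) dF i).
Proof.
move=> dFi; elim: r => [|i r IH].
  rewrite big_nil (_ : (fun _ => _) = cst 0); first exact: is_derive_cst.
  by apply/funext => u; rewrite big_nil.
rewrite big_cons (_ : (fun _ => _) = F i + (fun u => \sum_(i <- r) F i u)).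
  exact: is_deriveD.
by apply/funext => u; rewrite big_cons.
Qed.

(** By the chain rule, the factor [2^-1] cancelling the exponent. At [t = th] the two bracketed
    combinations are the coordinates of the rotated observation. *)
Lemma dPhiE N (x xs h : nat -> R) t :
  dPhi N x xs h t = \sum_(1 <= k < N.+1) h k *
    (x k * cos (2 * pi * k%:R * t) + xs k * sin (2 * pi * k%:R * t)) *
    (2 * pi * k%:R * (- x k * sin (2 * pi * k%:R * t) + xs k * cos (2 * pi * k%:R * t))).
Proof.
pose F k u := 2^-1 * (h k * (x k * cos (2 * pi * k%:R * u) + xs k * sin (2 * pi * k%:R * u)) ^+ 2).
have PhiE : Phi N x xs h = fun u => \sum_(1 <= k < N.+1) F k u.
  by apply/funext => u; rewrite /Phi mulr_sumr.
rewrite /dPhi derive1E PhiE.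
apply: derive_val.
apply: is_derive_bigsum => k.
set a := 2 * pi * k%:R.
have da : is_derive t 1 (fun u => a * u) a.
  rewrite -[X in is_derive _ _ _ X]mulr1.
  exact: (@is_deriveZ _ _ _ id a t 1 1).
have dc := is_derive1_comp (is_derive_cos (a * t)) da.
have ds := is_derive1_comp (is_derive_sin (a * t)) da.
have dv := is_deriveD (is_deriveZ (x k) dc) (is_deriveZ (xs k) ds).
have dF := is_deriveZ (2^-1 * h k) (is_deriveX 2 dv).
have -> : F k = (2^-1 * h k) \*: (x k \*: (cos \o *%R a) + xs k \*: (sin \o *%R a)) ^+ 2.
  by apply/funext => u; rewrite /F !fctE/= mulrA.
apply: is_derive_eq dF _.
rewrite !fctE /= expr1 /GRing.scale/=.
by field.
Qed.

(** Induction, with [(N + 1) ^+ 2 <= (N + 1) ^+ 3 - N ^+ 3]. This is the source of the power 3/2 of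
    [N] in the threshold. *)
Lemma sum_sqr_nat_le N : \sum_(k < N.+1) (k%:R : R) ^+ 2 <= N%:R ^+ 3.
Proof.
elim: N => [|N IH]; first by rewrite big_ord_recr big_ord0/= add0r expr0n !expr0n.
rewrite big_ord_recr/=.
have n0 : 0 <= N%:R :> R by [].
rewrite -natr1; nra.
Qed.

Lemma dnorm_partial_le (f : R -> R) n : dnorm_finite f ->
  \sum_(k < n) dnorm_terms f k <= dnorm f ^+ 2.
Proof.
move=> cvf.
have nd : {homo series (dnorm_terms f) : m n / (m <= n)%N >-> m <= n}.
  apply/nondecreasing_seqP => m; rewrite /series/= big_nat_recr//= lerDl.
  by rewrite /dnorm_terms mulr_ge0 ?sqr_ge0.
have le k := nondecreasing_cvgn_le nd cvf k.
rewrite /dnorm sqr_sqrtr; first by have := le n; rewrite /series/= big_mkord.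
by apply: le_trans (le 0%N); rewrite /series/= big_geq.
Qed.

Lemma powR_3_2_sqr N : (N%:R `^ (3 / 2)) ^+ 2 = N%:R ^+ 3 :> R.
Proof.
by rewrite -powR_mulrn ?powR_ge0// -powRrM divfK// powR_mulrn.
Qed.

End criterion.

(** * The deviation bound for the derivative of the criterion *)

Theorem lemma2 (R : realType) (d : measure_display) (T : measurableType d)
  (P : probability T R) (xi xis : nat -> T -> R)
  (th : R) (f : R -> R) (eps : R) (N : nat) (h : T -> nat -> R) (x : R) :
  iid_std_normal P xi xis ->
  admissible_signal f ->
  0 < eps < 1 ->
  (1 <= N)%N ->
  dnorm_finite f ->
  (forall w k, (1 <= k <= N)%N -> 0 <= h w k <= 1) ->
  (forall w k, (N < k)%N -> h w k = 0) ->
  (forall k (B : set R), measurable B ->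
     gen_sigma (fun j w => xobs th f eps (xi ^~ w) j ^+ 2
                           + xsobs th f eps (xis ^~ w) j ^+ 2)
               ((fun w => h w k) @^-1` B)) ->
  0 <= x <= Num.sqrt (N%:R / 6) ->
  (P [set w | (2 * x * eps * (dnorm f + 2 * pi * eps * N%:R `^ (3 / 2))
             < `| dPhi N (xobs th f eps (xi ^~ w)) (xsobs th f eps (xis ^~ w)) (h w) th |)%R ]
  <= ((2 * expR (- x ^+ 2))%R)%:E)%E.
Proof.
move=> iid _ /andP[e0 _] N1 dfin h01 _ mh /andP[x0 xN].
pose c k := cos (2 * pi * k%:R * th); pose s k := sin (2 * pi * k%:R * th).
have cs k : c k ^+ 2 + s k ^+ 2 = 1 by exact: cos2Dsin2.
pose W k w := rot (c k) (s k) (xi k w, xis k w).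
have WP : block_iid P W by exact: block_iid_rot cs (iid_std_normal_block iid).
pose u k w := fcoef f k + eps * (W k w).1.
have uE k w : xobs th f eps (xi ^~ w) k * c k + xsobs th f eps (xis ^~ w) k * s k = u k w.
  transitivity (fcoef f k * (c k ^+ 2 + s k ^+ 2) + eps * (W k w).1); last first.
    by rewrite cs mulr1.
  by rewrite /xobs /xsobs -/(c k) -/(s k) /W /rot/=; ring.
have vE k w : - xobs th f eps (xi ^~ w) k * s k + xsobs th f eps (xis ^~ w) k * c k =
    eps * (W k w).2.
  by rewrite /xobs /xsobs -/(c k) -/(s k) /W /rot/=; ring.
(* A rotation preserves the squared norm, so the second noise coordinate enters the data of the
   weights only through its square. *)
have rE k w : xobs th f eps (xi ^~ w) k ^+ 2 + xsobs th f eps (xis ^~ w) k ^+ 2 =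
    u k w ^+ 2 + (eps * (W k w).2) ^+ 2.
  rewrite -uE -vE; transitivity ((xobs th f eps (xi ^~ w) k ^+ 2 +
    xsobs th f eps (xis ^~ w) k ^+ 2) * (c k ^+ 2 + s k ^+ 2)); last by ring.
  by rewrite cs mulr1.
have mhs m k : measurable_fun [set: g_sigma_algebraType (cylinders W m flip_invariant)]
    (fun w => h w k).
  move=> _ B mB; rewrite setTI; move: (mh k B mB); rewrite /gen_sigma.
  apply: smallest_sub; first exact: smallest_sigma_algebra.
  move=> _ [j [D [_ mD ->]]].
  pose q z : R := (fcoef f j + eps * z.1) ^+ 2 + (eps * z.2) ^+ 2.
  have -> : (fun w => xobs th f eps (xi ^~ w) j ^+ 2 + xsobs th f eps (xis ^~ w) j ^+ 2)
      = q \o W j by apply/funext => w; rewrite rE.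
  have mq : measurable_fun [set: R * R] q.
    apply: measurable_funD; apply: measurable_funX; last exact: measurable_funM.
    by apply: measurable_funD => //; exact: measurable_funM.
  suff mqW : measurable_fun [set: g_sigma_algebraType (cylinders W m flip_invariant)]
      (q \o W j) by rewrite -[_ @^-1` D]setTI; exact: mqW.
  have [->|jm] := eqVneq j m; last exact: measurable_cylinders_other.
  by apply: measurable_cylinders_flip => // z; rewrite /q /flip/= mulrN sqrrN.
(* Truncation gives a bound valid at every index, including [k = 0], where [h] is unconstrained and
   which [Phi] omits. It also lets the sum in [Y] start at 0. *)
pose h' w k := if (1 <= k <= N)%N then h w k else 0.
have h'01 w k : 0 <= h' w k <= 1.
  by rewrite /h'; case: ifP => [/h01//|_]; rewrite lexx ler01.
have mh' m k : measurable_fun [set: g_sigma_algebraType (cylinders W m flip_invariant)]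
    (fun w => h' w k).
  by rewrite /h'; case: (1 <= k <= N)%N => //; exact: measurable_cst.
pose Y w := \sum_(k < N.+1) h' w k *
  (2 * pi * k%:R * eps ^+ 2 * (fcoef f k / eps + (W k w).1)) * (W k w).2.
have YE w : dPhi N (xobs th f eps (xi ^~ w)) (xsobs th f eps (xis ^~ w)) (h w) th = Y w.
  pose G k := h' w k *
    (2 * pi * k%:R * eps ^+ 2 * (fcoef f k / eps + (W k w).1)) * (W k w).2.
  rewrite dPhiE /Y -(big_mkord xpredT G) big_ltn// {1}/G /h'/= !mul0r add0r.
  apply: eq_big_nat => k; rewrite ltnS => kN.
  rewrite -/(c k) -/(s k) uE vE /G /h' kN /u.
  by field; rewrite gt_eqF.
under eq_set do rewrite YE.
set M := dnorm f + 2 * pi * eps * N%:R `^ (3 / 2).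
have D0 : 0 <= dnorm f by exact: sqrtr_ge0.
have pi0 : 0 < pi :> R by exact: pi_gt0.
have N0 : 0 < N%:R :> R by rewrite ltr0n.
have Q0 : 0 < N%:R `^ (3 / 2) :> R by exact: powR_gt0.
have Q2 := powR_3_2_sqr N (R := R).
set Q := N%:R `^ (3 / 2) in M Q0 Q2 *.
have peQ0 : 0 < 2 * pi * eps * Q by rewrite !mulr_gt0.
have M0 : 0 < M by rewrite /M; lra.
(* The nonnegative cross term of the square is dropped. *)
have M2 : dnorm f ^+ 2 + (2 * pi * eps) ^+ 2 * N%:R ^+ 3 <= M ^+ 2.
  by rewrite -Q2 -exprMn /M; nra.
have x2 : x ^+ 2 <= N%:R / 6.
  by rewrite -(@sqr_sqrtr _ (N%:R / 6)) ?divr_ge0// ler_sqr ?nnegrE ?sqrtr_ge0.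
(* For the threshold [2 * x * eps * M] this gives [expR (- 2 * x ^+ 2)] in Chernoff's bound, against
   a generating function of at most [expR (x ^+ 2)]. *)
pose l := x / (eps * M).
have l0 : 0 <= l by rewrite divr_ge0// mulr_ge0 ?ltW.
(* Only the square of the parameter matters, so [l] and [- l] are treated together. *)
have mgf (l' : R) : l' ^+ 2 = l ^+ 2 ->
    (\int[P]_w (expR (l' * Y w))%:E <= (expR (x ^+ 2))%:E)%E.
  move=> l'2.
  have lM : (l * eps * M) ^+ 2 = x ^+ 2.
    by rewrite /l; congr (_ ^+ 2); field; rewrite !gt_eqF.
  under eq_integral => w _.
    rewrite /Y mulr_sumr (eq_bigr (fun k : 'I_N.+1 => h' w k * (l' * (2 * pi * k%:R * eps ^+ 2)
      * (fcoef f k / eps + (W k w).1)) * (W k w).2)); last by move=> k _; ring.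
    over.
  have dl0 : 0 <= (l * eps) ^+ 2 by exact: sqr_ge0.
  have lM' : (l * eps) ^+ 2 * M ^+ 2 = x ^+ 2 by rewrite -exprMn lM.
  apply: (le_trans (@mgf_weighted_le _ _ _ P W WP h'
    (fun k => l' * (2 * pi * k%:R * eps ^+ 2)) (fun k => fcoef f k / eps) N.+1 h'01 mh' _)).
    move=> k; have [kN|] := leqP k N; last by right.
    left; set B := (l * eps) ^+ 2 * (2 * pi * eps) ^+ 2.
    have B0 : 0 <= B by rewrite mulr_ge0 ?sqr_ge0.
    (* Here the range of [x] enters: [B * N ^+ 3 <= (l * eps) ^+ 2 * M ^+ 2 = x ^+ 2 <= N / 6], and
       one divides by [N]. Hence every squared coefficient is below [2^-1]. *)
    have BN : B * N%:R ^+ 2 <= 6^-1.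
      rewrite -(ler_pM2r N0) -mulrA -exprSr (mulrC 6^-1).
      apply: le_trans x2; rewrite -lM' -[leLHS]mulrA; apply: ler_wpM2l => //.
      by apply: le_trans M2; rewrite lerDr sqr_ge0.
    have -> : (l' * (2 * pi * k%:R * eps ^+ 2)) ^+ 2 = B * k%:R ^+ 2.
      by rewrite exprMn l'2 /B; ring.
    have kN2 : B * k%:R ^+ 2 <= B * N%:R ^+ 2.
      by rewrite ler_wpM2l// ler_sqr ?nnegrE ?ler_nat.
    by apply: le_trans kN2 (le_trans BN _); lra.
  rewrite lee_fin ler_expR -lM'.
  (* The factor [1 + p ^+ 2] separates a pure noise part, summed by [sum_sqr_nat_le], from the terms
     of the squared norm of the derivative. *)
  rewrite (eq_bigr (fun k : 'I_N.+1 => (l * eps) ^+ 2 *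
    ((2 * pi * eps) ^+ 2 * k%:R ^+ 2 + dnorm_terms f k))); last first.
    move=> k _; rewrite /dnorm_terms exprMn l'2.
    by field; rewrite gt_eqF.
  rewrite -mulr_sumr ler_wpM2l// big_split/= -mulr_sumr.
  apply: le_trans M2; rewrite addrC lerD//; first exact: dnorm_partial_le.
  by rewrite ler_wpM2l ?sqr_ge0//; exact: sum_sqr_nat_le.
have -> : expR (- x ^+ 2) = expR (- (l * (2 * x * eps * M))) * expR (x ^+ 2).
  by rewrite -expRD; congr expR; rewrite /l; field; rewrite !gt_eqF.
apply: chernoff2 => //.
- apply: measurable_sum => k; apply: measurable_funM; last first.
    by apply: measurableT_comp => //; case: WP.
  apply: measurable_funM; first exact: (measurable_of_sym_algebra WP (mh' 0%N k)).
  apply: measurable_funM => //; apply: measurable_funD => //.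
  by apply: measurableT_comp => //; case: WP.
- exact: mgf.
- by apply: mgf; rewrite sqrrN.
Qed.
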